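(* For every graph $G$, $\mathrm{scw}(G) \le \mathrm{cw}(G) \le 2\,\mathrm{scw}(G)$, where $\mathrm{cw}(G)$ denotes the clique-width and $\mathrm{scw}(G)$ the slick clique-width of $G$.
   Context: Graphs are finite, simple, undirected, with at least one vertex. For a positive integer $k$ let $[k]=\{1,\dots,k\}$. A labeled graph (with labels in $[k]$) is a graph in which each vertex is assigned exactly one label in $[k]$. A $k$-expression is an expression formed from atoms $i(v)$, unary operations $\eta_{i,j}$ and $\rho_{i\to j}$, and a binary operation $\oplus$, with $i,j\in[k]$, where: $i(v)$ creates a single vertex $v$ with label $i$; $\eta_{i,j}$ (for $i\ne j$) adds all edges not already present between every vertex with label $i$ and every vertex with label $j$; $\rho_{i\to j}$ changes all labels $i$ to $j$; $\oplus$ forms the disjoint union of two labeled graphs. The graph generated by a $k$-expression is obtained by deleting the labels. The clique-width $\mathrm{cw}(G)$ is the smallest $k$ such that $G$ is generated by a $k$-expression. A slick $k$-expression is an expression formed from atoms $i(v)$ (with $i\in[k]$, creating a single vertex $v$ with label $i$) and binary operations $\oplus_{S,L,R}$, where $L,R$ are functions $[k]\to[k]$ and $S\subseteq[k]\times[k]$. For labeled graphs $G,H$ with labels in $[k]$, $G\oplus_{S,L,R}H$ is obtained as follows: take the disjoint union of $G$ and $H$; add edges from every vertex labeled $i$ in $G$ to every vertex labeled $j$ in $H$ for all $(i,j)\in S$; afterwards replace every label $i$ of a vertex of $G$ by $L(i)$ and every label $i$ of a vertex of $H$ by $R(i)$. The graph generated by a slick $k$-expression is obtained by deleting the labels. The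 slick clique-width $\mathrm{scw}(G)$ is the smallest $k$ such that $G$ is generated by a slick $k$-expression. *)

(* Defs.v *)
From mathcomp Require Import all_boot.
From mathcomp Require Import boolp.

Set Implicit Arguments.
Unset Strict Implicit.
Unset Printing Implicit Defensive.

Record sgraph := SGraph {
  vertex :> finType;
  adj : rel vertex;
  adj_sym : symmetric adj;
  adj_irr : irreflexive adj;
  vertex_gt0 : 0 < #|vertex| }.

Definition isomorphic (G H : sgraph) : Prop :=
  exists2 f : G -> H, bijective f & forall x y, adj (f x) (f y) = adj x y.

(* Labels are taken in 'I_k = {0, ..., k-1} instead of {1, ..., k}. *)
Record lgraph (k : nat) := LGraph {
  unlabel :> sgraph;
  lab : unlabel -> 'I_k }.

Section Operations.
Variable k : nat.
Implicit Types (i j : 'I_k) (G H : lgraph k).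

Lemma single_sym : symmetric (fun _ _ : unit => false).
Proof. by []. Qed.

Lemma single_irr : irreflexive (fun _ : unit => fun _ => false).
Proof. by []. Qed.

Lemma single_gt0 : 0 < #|{: unit}|.
Proof. by rewrite card_unit. Qed.

Definition single i : lgraph k :=
  @LGraph k (SGraph single_sym single_irr single_gt0) (fun=> i).

Definition join_adj i j G : rel G := fun x y =>
  [|| adj x y, (lab x == i) && (lab y == j) | (lab x == j) && (lab y == i)].

Lemma join_sym i j G : symmetric (@join_adj i j G).
Proof.
move=> x y; rewrite /join_adj adj_sym; congr (_ || _).
by rewrite orbC; congr (_ || _); rewrite andbC.
Qed.

Lemma join_irr i j G : i != j -> irreflexive (@join_adj i j G).
Proof.
move=> ij x; rewrite /join_adj adj_irr /=.
by case: eqP => [->|_]; rewrite ?(negbTE ij) ?andbF.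
Qed.

Definition join i j (ij : i != j) G : lgraph k :=
  LGraph (k := k)
    (unlabel := SGraph (@join_sym i j G) (join_irr ij) (vertex_gt0 G))
    (@lab k G).

Definition relabel i j G : lgraph k :=
  @LGraph k G (fun x => if lab x == i then j else lab x).

Definition dunion_adj G H : rel (G + H)%type := fun u v =>
  match u, v with
  | inl x, inl y => adj x y
  | inr x, inr y => adj x y
  | _, _ => false
  end.

Lemma dunion_sym G H : symmetric (@dunion_adj G H).
Proof. by case=> x [] y //=; rewrite adj_sym. Qed.

Lemma dunion_irr G H : irreflexive (@dunion_adj G H).
Proof. by case=> x /=; rewrite adj_irr. Qed.

Lemma sum_gt0 G H : 0 < #|{: G + H}|.
Proof. by rewrite card_sum addn_gt0 vertex_gt0. Qed.

Definition dunion_lab (L R : 'I_k -> 'I_k) G H (u : G + H) : 'I_k :=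
  match u with inl x => L (lab x) | inr y => R (lab y) end.

Definition dunion G H : lgraph k :=
  @LGraph k (SGraph (@dunion_sym G H) (@dunion_irr G H) (sum_gt0 G H))
    (@dunion_lab id id G H).

(* The edges added by E are read off the labels held before L and R act. *)
Definition slick_adj (E : {set 'I_k * 'I_k}) G H : rel (G + H)%type :=
  fun u v => dunion_adj u v ||
    match u, v with
    | inl x, inr y => (lab x, lab y) \in E
    | inr y, inl x => (lab x, lab y) \in E
    | _, _ => false
    end.

Lemma slick_sym E G H : symmetric (@slick_adj E G H).
Proof. by move=> u v; rewrite /slick_adj dunion_sym; case: u v => x [] y. Qed.

Lemma slick_irr E G H : irreflexive (@slick_adj E G H).
Proof. by move=> u; rewrite /slick_adj dunion_irr; case: u. Qed.

Definition slick_union (E : {set 'I_k * 'I_k}) (L R : 'I_k -> 'I_k) G H :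
    lgraph k :=
  @LGraph k (SGraph (@slick_sym E G H) (@slick_irr E G H) (sum_gt0 G H))
    (@dunion_lab L R G H).

End Operations.

(* Atoms do not name their vertex: every occurrence of an atom is a new vertex,
   the disjoint union is the sum of the vertex types, and a graph is generated
   by an expression when it is isomorphic to the value of the expression. *)
Inductive kexpr (k : nat) : Type :=
| KAtom of 'I_k
| KJoin (i j : 'I_k) of i != j & kexpr k
| KRelabel of 'I_k & 'I_k & kexpr k
| KUnion of kexpr k & kexpr k.

Fixpoint keval (k : nat) (e : kexpr k) : lgraph k :=
  match e with
  | KAtom i => single i
  | KJoin _ _ ij e1 => join ij (keval e1)
  | KRelabel i j e1 => relabel i j (keval e1)
  | KUnion e1 e2 => dunion (keval e1) (keval e2)
  end.

Inductive slick_expr (k : nat) : Type :=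
| SAtom of 'I_k
| SUnion of {set 'I_k * 'I_k} & ('I_k -> 'I_k) & ('I_k -> 'I_k)
    & slick_expr k & slick_expr k.

Fixpoint seval (k : nat) (e : slick_expr k) : lgraph k :=
  match e with
  | SAtom i => single i
  | SUnion E L R e1 e2 => slick_union E L R (seval e1) (seval e2)
  end.

(* There is no expression at all for k = 0, so positivity of k is automatic. *)
Definition cw_generated (G : sgraph) (k : nat) : Prop :=
  exists e : kexpr k, isomorphic G (keval e).

Definition scw_generated (G : sgraph) (k : nat) : Prop :=
  exists e : slick_expr k, isomorphic G (seval e).

Section Existence.
Variable G : sgraph.
Let n := #|G|.
Let rk (x : G) : 'I_n := enum_rank x.

(* H is a copy of (s, r), each vertex being labeled by its rank in G. *)
Definition represents (H : lgraph n) (s : seq G) (r : rel G) : Prop :=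
  exists f : H -> G, [/\ injective f, codom f =i s,
    forall x, lab x = rk (f x) & forall x y, adj x y = r (f x) (f y)].

Lemma represents_iso (H : lgraph n) :
  represents H (enum G) (@adj G) -> isomorphic G H.
Proof.
move=> [f [finj fim _ fadj]].
have fs y : y \in codom f by rewrite fim mem_enum.
exists (fun y => iinv (fs y)) => [|x y]; last by rewrite fadj !f_iinv.
by exists f => [y|x]; [rewrite f_iinv | apply: finj; rewrite f_iinv].
Qed.

Lemma represents_ext (H : lgraph n) s (r r' : rel G) :
  r =2 r' -> represents H s r -> represents H s r'.
Proof.
by move=> rr' [f [? ? ? fadj]]; exists f; split=> // x y; rewrite -rr' fadj.
Qed.

Lemma represents_single a (r : rel G) :
  irreflexive r -> represents (single (rk a)) [:: a] r.
Proof.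
move=> ri; exists (fun=> a); split=> [[] []| x | |] //=; rewrite ?inE.
by apply/codomP/eqP => [[] | ->] //; exists tt.
Qed.

Lemma represents_slick (H : lgraph n) a s (r : rel G) :
    symmetric r -> irreflexive r -> a \notin s -> represents H s r ->
  represents (slick_union [set p | r (enum_val p.1) (enum_val p.2)] id id
                (single (rk a)) H) (a :: s) r.
Proof.
move=> rs ri as_ [f [finj fim flab fadj]].
have fa y : f y != a by apply: contraNneq as_ => <-; rewrite -fim codom_f.
exists (fun u => match u with inl _ => a | inr y => f y end); split.
- move=> [[]|x] [[]|y] //= e; last by rewrite (finj _ _ e).
  + by move: (fa y); rewrite -e eqxx.
  + by move: (fa x); rewrite e eqxx.
- move=> x; rewrite inE -fim; apply/codomP/predU1P => [[[[]|y] ->]|[->|]].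
  + by left.
  + by right; apply: codom_f.
  + by exists (inl tt).
  + by move=> /codomP[y ->]; exists (inr y).
- by case=> [[]|y] //=; rewrite flab.
- by case=> [[]|x] [[]|y] /=; rewrite /slick_adj /= ?inE /= ?flab ?enum_rankK
    ?orbF ?ri // rs.
Qed.

Lemma represents_dunion (H : lgraph n) a s :
    a \notin s -> represents H s (fun _ _ => false) ->
  represents (dunion (single (rk a)) H) (a :: s) (fun _ _ => false).
Proof.
move=> as_ rep_s.
have [f [finj fim flab fadj]] := @represents_slick H a s (fun _ _ => false)
  (fun _ _ => erefl) (fun=> erefl) as_ rep_s.
exists f; split=> // x y.
by rewrite -(fadj x y) /= /slick_adj; case: x y => x [] y /=; rewrite ?inE ?orbF.
Qed.

Lemma represents_join (H : lgraph n) (a b : G) (ab : rk a != rk b) s r :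
    represents H s r ->
  represents (join ab H) s (fun x y =>
    [|| r x y, (x == a) && (y == b) | (x == b) && (y == a)]).
Proof.
move=> [f [finj fim flab fadj]]; exists f; split=> // x y.
by rewrite /= /join_adj !flab fadj !(inj_eq enum_rank_inj).
Qed.

Lemma enum_neq0 : enum G != [::].
Proof. by rewrite -size_eq0 -cardE -lt0n vertex_gt0. Qed.

Lemma scw_generated_exists : exists k, `[< scw_generated G k >].
Proof.
exists n; apply/asboolP.
suff [e /represents_iso] : exists e : slick_expr n,
  represents (seval e) (enum G) (@adj G) by exists e.
elim: (enum G) (enum_uniq G) enum_neq0 => // a [|b s] IH /andP[as_ us] _.
  by exists (SAtom (rk a)); apply: represents_single; apply: adj_irr.
have [//|//|e rep_e] := IH.
eexists (SUnion _ id id (SAtom (rk a)) e).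
by apply: represents_slick => //; [apply: adj_sym | apply: adj_irr].
Qed.

Lemma cw_generated_exists : exists k, `[< cw_generated G k >].
Proof.
exists n; apply/asboolP.
have [e0 rep_e0] : exists e : kexpr n,
    represents (keval e) (enum G) (fun _ _ => false).
  elim: (enum G) (enum_uniq G) enum_neq0 => // a [|b s] IH /andP[as_ us] _.
    by exists (KAtom (rk a)); apply: represents_single.
  have [//|//|e rep_e] := IH.
  by exists (KUnion (KAtom (rk a)) e); apply: represents_dunion.
suff [e rep_e] : exists e : kexpr n, represents (keval e) (enum G) (fun x y =>
    has (fun p => adj p.1 p.2 && ((x == p.1) && (y == p.2) ||
                                  (x == p.2) && (y == p.1)))
        (enum {: G * G})).
  exists e; apply: represents_iso; apply: represents_ext rep_e => x y.
  apply/hasP/idP => [[[a b] _ /= /andP[ab]]|xy].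
    by case/orP=> /andP[/eqP-> /eqP->]; rewrite // adj_sym.
  by exists (x, y); rewrite ?mem_enum //= xy !eqxx.
elim: (enum {: G * G}) => [|[a b] l [e rep_e]] /=; first by exists e0.
have [ab|nab] := boolP (adj a b); last by exists e.
have rab : rk a != rk b.
  by rewrite (inj_eq enum_rank_inj); apply: contraTneq ab => ->; rewrite adj_irr.
exists (KJoin rab e); apply: represents_ext (represents_join rab rep_e) => x y.
by rewrite orbC.
Qed.

End Existence.

Definition cw (G : sgraph) : nat := ex_minn (cw_generated_exists G).

Definition scw (G : sgraph) : nat := ex_minn (scw_generated_exists G).

(* Main.v *)
Require Import Defs.
From mathcomp Require Import all_boot.
From mathcomp Require Import fingroup perm boolp.

(** For [scw <= cw], the joins and relabelings of a k-expression are pushed down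
    to the leaves: an edge created by a later join depends only on the current
    labels, so each disjoint union can add at once the edges between its two
    sides that all later joins will create.

    For [cw <= 2 scw], keep the labels of the two sides of a slick union in
    disjoint halves of a set of 2k labels, add the edges by joins, and relabel.
    The only difficulty is to realize an arbitrary simultaneous relabeling by
    successive ones, which can fail (for instance for a permutation) but works
    for idempotent maps.  Since every self-map of a finite set is an idempotent
    map after a permutation, the permutation can be pushed into the
    subexpressions. *)

Set Implicit Arguments.
Unset Strict Implicit.
Unset Printing Implicit Defensive.

(** Take [p] agreeing with [h] at as many points as possible and [m] equal to [h] after the inverse
    of [p]. Idempotence of [m] then means that the [p]-preimage of each value [h x] lies in the same
    fiber of [h] as [x]. *)
Lemma perm_idempotent_factor (T : finType) (h : T -> T) :
  exists p : {perm T}, exists2 m : T -> T, idempotent_fun m & m \o p =1 h.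
Proof.
pose agree (p : {perm T}) := [set x | p x == h x].
have [p _ pmax] := @arg_maxnP _ (1%g : {perm T}) xpredT (fun p => #|agree p|) isT.
suff fib x : h ((p^-1)%g (h x)) = h x.
  exists p, (h \o (p^-1)%g) => x /=; last by rewrite permK.
  exact: fib.
(* Otherwise, correcting p by a transposition makes it agree with h at x too. *)
apply/eqP/negPn/negP => hx; set y := (p^-1)%g (h x) in hx.
have py : p y = h x by rewrite permKV.
have pxN : p x != h x.
  by apply: contraNneq hx => /(canRL (permK p)) e; rewrite /y -e.
have := pmax (p * tperm (p x) (h x))%g isT; rewrite /= leqNgt => /negP; apply.
apply: proper_card; apply/properP; split; last first.
  by exists x; rewrite inE ?permM ?tpermL.
apply/subsetP => z; rewrite !inE permM => /eqP pz.
(* Composing with the transposition changes [p] only at [x] and [y], and [p] does not agree with [h]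
   at [y]: that would give [h y = h x]. *)
case: tpermP => [/perm_inj zx|pzx|_ _]; last by rewrite pz.
- by rewrite zx.
- by case/eqP: hx; rewrite /y -pzx permK -pz.
Qed.

Section Copies.
Variable k : nat.

(** Labeled isomorphism, against a bare relation and labeling, so that both can be modified without
    rebuilding a graph. *)
Definition copy (H : lgraph k) (T : Type) (r : rel T) (l : T -> 'I_k) : Prop :=
  exists f : T -> H, [/\ bijective f, forall x y, adj (f x) (f y) = r x y
    & forall x, lab (f x) = l x].

Lemma copy_ext H T (r r' : rel T) l l' :
  r =2 r' -> l =1 l' -> copy H r l -> copy H r' l'.
Proof.
move=> rr ll [f [fb fr fl]]; exists f.
by split=> // [x y|x]; rewrite -?rr -?ll.
Qed.

Lemma copy_isomorphic (H : lgraph k) (G : sgraph) l :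
  copy H (@adj G) l -> isomorphic G H.
Proof. by case=> f [fb fr _]; exists f. Qed.

Lemma copy_comp (H : lgraph k) T T' (g : T' -> T) (r : rel T) l :
  bijective g -> copy H r l -> copy H (fun x y => r (g x) (g y)) (l \o g).
Proof.
move=> gb [f [fb fr fl]]; exists (f \o g).
by split=> [|x y|x] /=; [apply: bij_comp | apply: fr | apply: fl].
Qed.

Lemma copy_single T i (r : rel T) (l : T -> 'I_k) (x0 : T) :
  (forall x, x = x0) -> irreflexive r -> l x0 = i -> copy (single i) r l.
Proof.
move=> T1 ri lx; exists (fun=> tt); split=> [|x y|x].
- by exists (fun=> x0) => [x|[]].
- by rewrite (T1 x) (T1 y) ri.
- by rewrite (T1 x) lx.
Qed.

Lemma copy_relabel H T (r : rel T) l i j :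
  copy H r l -> copy (relabel i j H) r (fun x => if l x == i then j else l x).
Proof. by case=> f [fb fr fl]; exists f; split=> // x /=; rewrite fl. Qed.

Lemma copy_join H T (r : rel T) l i j (ij : i != j) : copy H r l ->
  copy (join ij H) (fun x y =>
    [|| r x y, (l x == i) && (l y == j) | (l x == j) && (l y == i)]) l.
Proof.
by case=> f [fb fr fl]; exists f; split=> // x y; rewrite /= /join_adj fr !fl.
Qed.

Definition sum_rel T1 T2 (r1 : rel T1) (r2 : rel T2) (c : T1 -> T2 -> bool) :
    rel (T1 + T2)%type := fun u v =>
  match u, v with
  | inl x, inl y => r1 x y
  | inr x, inr y => r2 x y
  | inl x, inr y => c x y
  | inr y, inl x => c x y
  end.

Definition sum_fun T1 T2 T (f : T1 -> T) (g : T2 -> T) (u : (T1 + T2)%type) :=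
  match u with inl x => f x | inr y => g y end.

Lemma bij_sum T1 T2 U1 U2 (f : T1 -> U1) (g : T2 -> U2) :
  bijective f -> bijective g ->
  bijective (sum_fun (fun x => inl U2 (f x)) (fun y => inr U1 (g y))).
Proof.
move=> [f' fK f'K] [g' gK g'K].
by exists (sum_fun (fun x => inl T2 (f' x)) (fun y => inr T1 (g' y)));
  case=> x /=; rewrite ?fK ?gK ?f'K ?g'K.
Qed.

Lemma copy_slick H1 H2 T1 T2 (r1 : rel T1) (r2 : rel T2) l1 l2 E L R :
  copy H1 r1 l1 -> copy H2 r2 l2 ->
  copy (slick_union E L R H1 H2)
    (sum_rel r1 r2 (fun x y => (l1 x, l2 y) \in E))
    (sum_fun (L \o l1) (R \o l2)).
Proof.
move=> [f [fb fr fl]] [g [gb gr gl]].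
exists (sum_fun (fun x => inl _ (f x)) (fun y => inr _ (g y))).
split; first exact: bij_sum.
- by case=> x [] y; rewrite /= /slick_adj /= ?orbF ?fr ?gr ?fl ?gl.
- by case=> x; rewrite /= ?fl ?gl.
Qed.

Lemma copy_dunion H1 H2 T1 T2 (r1 : rel T1) (r2 : rel T2) l1 l2 :
  copy H1 r1 l1 -> copy H2 r2 l2 ->
  copy (dunion H1 H2) (sum_rel r1 r2 (fun _ _ => false)) (sum_fun l1 l2).
Proof.
move=> [f [fb fr fl]] [g [gb gr gl]].
exists (sum_fun (fun x => inl _ (f x)) (fun y => inr _ (g y))).
split; first exact: bij_sum.
- by case=> x [] y; rewrite /= ?fr ?gr.
- by case=> x; rewrite /= ?fl ?gl.
Qed.

Definition kcopy T (r : rel T) (l : T -> 'I_k) : Prop :=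
  exists e : kexpr k, copy (keval e) r l.

Lemma kcopy_ext T (r r' : rel T) l l' :
  r =2 r' -> l =1 l' -> kcopy r l -> kcopy r' l'.
Proof. by move=> rr ll [e He]; exists e; apply: copy_ext He. Qed.

(** Relabel each [i] to [m i] in turn: a label already moved is a fixed point of [m], so later steps
    leave it unchanged. *)
Lemma kcopy_idempotent T (r : rel T) l (m : 'I_k -> 'I_k) :
  idempotent_fun m -> kcopy r l -> kcopy r (m \o l).
Proof.
move=> mm [e He].
suff: kcopy r (fun x => if l x \in enum 'I_k then m (l x) else l x).
  by apply: kcopy_ext => // x; rewrite mem_enum.
elim: (enum 'I_k) => [|i s [e' He']]; first by exists e.
exists (KRelabel i (m i) e'); apply: copy_ext (copy_relabel i (m i) He') => // x.
rewrite inE; case: (boolP (l x \in s)) => _; last first.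
  by case: eqP => [->|].
by rewrite orbT; case: eqP => [<-|//]; apply: mm.
Qed.

(** Joins do not alter labels, so the pairs of [E] can be joined one after the other. *)
Lemma kcopy_join T (r : rel T) l (E : rel 'I_k) :
  symmetric E -> irreflexive E -> kcopy r l ->
  kcopy (fun x y => r x y || E (l x) (l y)) l.
Proof.
move=> Es Ei [e0 He0].
suff: kcopy (fun x y => r x y || has (fun p => E p.1 p.2 &&
   ((l x == p.1) && (l y == p.2) || (l x == p.2) && (l y == p.1)))
     (enum {: 'I_k * 'I_k})) l.
  apply: kcopy_ext => // x y; congr (_ || _); apply/hasP/idP.
    by case=> -[i j] _ /= /andP[ij] /orP[] /andP[/eqP-> /eqP->]; rewrite // Es.
  by move=> xy; exists (l x, l y); rewrite ?mem_enum //= xy !eqxx.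
elim: (enum _) => [|[i j] s [e He]] /=.
  by exists e0; apply: copy_ext He0 => // x y; rewrite orbF.
have [ij|nij] := boolP (E i j); last by exists e.
have nij : i != j by apply: contraTneq ij => ->; rewrite Ei.
exists (KJoin nij e); apply: copy_ext (copy_join nij He) => // x y.
by rewrite -!orbA; congr (_ || _); rewrite orbC -!orbA.
Qed.

End Copies.

(** Induction on [e], where [E] and [f] record the joins and relabelings still pending above [e], in
    terms of its current labels. *)
Lemma slick_of_kexpr k (e : kexpr k) (E : rel 'I_k) (f : 'I_k -> 'I_k) :
  symmetric E -> irreflexive E ->
  exists s : slick_expr k, copy (seval s)
    (fun x y : keval e => adj x y || E (lab x) (lab y)) (fun x => f (lab x)).
Proof.
elim: e E f => [i|i j ij e IH|i j e IH|e1 IH1 e2 IH2] E f Es Ei.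
- exists (SAtom (f i)); apply: (@copy_single _ _ _ _ _ tt) => [[]|x|] //=.
- have [||s Hs] := IH (fun a b =>
    [|| (a == i) && (b == j), (a == j) && (b == i) | E a b]) f.
  + by move=> a b; rewrite Es orbCA (andbC (a == j)) (andbC (a == i)).
  + move=> a; rewrite Ei orbF andbC orbb.
    by apply/negP => /andP[/eqP-> /eqP ji]; rewrite ji eqxx in ij.
  exists s; apply: copy_ext Hs => // x y.
  by rewrite /= /join_adj -!orbA.
(* Pending joins act on the new labels, so [E] is pulled back along [g]. *)
- pose g a := if a == i then j else a.
  have [||s Hs] := IH (fun a b => E (g a) (g b)) (f \o g).
  + by move=> a b; apply: Es.
  + by move=> a; apply: Ei.
  by exists s.
(* Both sides keep their labels, from which the union reads the cross edges before it applies
   [f]. *)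
- have [//|//|s1 H1] := IH1 E id; have [//|//|s2 H2] := IH2 E id.
  exists (SUnion [set p | E p.1 p.2] f f s1 s2).
  apply: copy_ext (copy_slick _ f f H1 H2); last by case.
  by case=> x [] y; rewrite /= ?inE //= Es.
Qed.

(** [q] splits the labels into one half for each side of a union. Leaving [c] arbitrary lets the
    induction absorb both the relabelings and the permutation. *)
Lemma kexpr_of_slick k n (q : 'I_k + 'I_k -> 'I_n) (s : slick_expr k)
    (c : 'I_k -> 'I_n) :
  bijective q -> kcopy (@adj (seval s)) (fun x => c (lab x)).
Proof.
move=> [q' qK q'K]; elim: s c => [i|E L R s1 IH1 s2 IH2] c.
  by exists (KAtom (c i)); apply: (@copy_single _ _ _ _ _ tt) => [[]|x|].
(* This is the relabeling due after the joins; its factor [p] is already built into the labels of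
   [e1] and [e2]. *)
have [p [m mm mp]] := perm_idempotent_factor (sum_fun (c \o L) (c \o R) \o q').
have [e1 H1] := IH1 (fun i => p (q (inl i))).
have [e2 H2] := IH2 (fun i => p (q (inr i))).
(* [t] recovers the side and the original label, so that [C] relates only labels of opposite
   sides. *)
pose t a := q' ((p^-1)%g a).
have tK u : t (p (q u)) = u by rewrite /t permK qK.
pose none := fun _ _ : 'I_k => false.
pose C a b := sum_rel none none (fun i j => (i, j) \in E) (t a) (t b).
have Cs : symmetric C by move=> a b; rewrite /C; case: (t a) (t b) => i [].
have Ci : irreflexive C by move=> a; rewrite /C; case: (t a).
have := kcopy_idempotent mm (kcopy_join Cs Ci
  (ex_intro _ (KUnion e1 e2) (copy_dunion H1 H2))).
apply: kcopy_ext.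
- by case=> x [] y; rewrite /= /C /= !tK /slick_adj /= ?orbF.
- by case=> x; rewrite /= -[m _]/((m \o p) _) mp /= qK.
Qed.

Theorem theorem1 : forall G : sgraph, scw G <= cw G <= 2 * scw G.
Proof.
move=> G; rewrite /scw /cw.
case: ex_minnP => a /asboolP[s [g gb gadj]] amin.
case: ex_minnP => b /asboolP[e [f fb fadj]] bmin.
apply/andP; split.
- apply: amin; apply/asboolP.
  have [//|//|s' Hs] := @slick_of_kexpr _ e (fun _ _ => false) id.
  exists s'; apply: copy_isomorphic (copy_ext _ _ (copy_comp fb Hs)) => // x y.
  by rewrite orbF fadj.
- apply: bmin; apply/asboolP.
  have aa : a + a = 2 * a by rewrite addnn mul2n.
  pose q u := cast_ord aa (@unsplit a a u).
  have qb : bijective q.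
    exists (fun i => split (cast_ord (esym aa) i)) => [u|i].
      by rewrite /q cast_ordK unsplitK.
    by rewrite /q splitK cast_ordKV.
  (* The final labels are deleted, so any [c] would do. *)
  have [e' He] := kexpr_of_slick s (fun i => q (inl i)) qb.
  by exists e'; apply: copy_isomorphic (copy_ext _ _ (copy_comp gb He)).
Qed.
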